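(* For every integer $r\geq 2$, the graph $H_{4, 4^r}$ is hyperenergetic.
   Context: For an integer $r\ge 1$, the Galois ring of characteristic $4$ and order $4^r$ is $GR(4,4^r) := \mathbb{Z}_4[x]/(f(x))$, where $\mathbb{Z}_4=\mathbb{Z}/4\mathbb{Z}$ and $f(x)\in\mathbb{Z}_4[x]$ is a monic polynomial of degree $r$ whose reduction modulo $2$ is irreducible over $\mathbb{Z}_2$ (up to isomorphism, the ring does not depend on $f$). $GR^+(4,4^r)$ and $GR^*(4,4^r)$ denote its additive group and its group of units. $GR^*(4,4^r)$ contains a unique subgroup $G_1$ of order $2^r-1$, which is cyclic. For an additively written group $\Gamma$ and $S\subset\Gamma\setminus\{0\}$ with $S=-S$, the Cayley graph $Cay(\Gamma,S)$ has vertex set $\Gamma$, with $x,y$ adjacent if and only if $x-y\in S$. For $r\ge 2$ define $H_{4,4^r} := Cay(GR^+(4,4^r), G_1\cup -G_1)$. Eigenvalues of a graph are the eigenvalues of its adjacency matrix. The energy of a graph $G$ is $E(G):=\sum_{\lambda}|\lambda|$, where $\lambda$ runs over all eigenvalues of $G$ counted with multiplicity. A graph $G$ with $n$ vertices is called hyperenergetic if $E(G)>2(n-1)$. *)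

(* Defs.v *)
From HB Require Import structures.
From mathcomp Require Import all_boot all_order all_algebra all_fingroup.
From mathcomp Require Import all_field qpoly.

Set Implicit Arguments.
Unset Strict Implicit.
Unset Printing Implicit Defensive.

Import Order.TTheory GRing.Theory Num.Theory.
Local Open Scope ring_scope.

Section GraphEnergy.

Variables (T : finType) (e : rel T).

Definition adj_mx : 'M[algC]_#|T| :=
  \matrix_(i, j) (e (enum_val i) (enum_val j))%:R.

(* The roots of the characteristic polynomial, with multiplicity. They live in
   algC because adj_mx is an integer matrix. *)
Definition spectrum : seq algC :=
  sval (closed_field_poly_normal (char_poly adj_mx)).

Lemma spectrumE : char_poly adj_mx = \prod_(z <- spectrum) ('X - z%:P).
Proof.
rewrite /spectrum; case: closed_field_poly_normal => s /= {1}->.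
by rewrite (monicP (char_poly_monic _)) scale1r.
Qed.

Definition energy : algC := \sum_(z <- spectrum) `|z|.

Definition hyperenergetic : Prop := 2 * (#|T|%:R - 1) < energy.

End GraphEnergy.

Definition cayley (V : finZmodType) (S : {set V}) : rel V :=
  fun x y => x - y \in S.

Definition red2 (a : 'Z_4) : 'F_2 := (val a)%:R.

Definition galois_poly (r : nat) (f : {poly 'Z_4}) : Prop :=
  [/\ f \is monic, size f = r.+1 & irreducible_poly (map_poly red2 f)].

(* The alias carries the finite and unit ring structures, which {poly %/ f}
   only has over a field. When f is not monic of positive degree, {poly %/ f}
   is the quotient by 'X; galois_poly r f with 0 < r excludes this. *)
Definition GR4 (f : {poly 'Z_4}) : predArgType := {poly %/ f}.

HB.instance Definition _ f := GRing.ComNzRing.on (GR4 f).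
HB.instance Definition _ f :=
  Finite.copy (GR4 f) {poly_(size (mk_monic f)).-1 'Z_4}.
HB.instance Definition _ f := FinRing.isNzRing.Build (GR4 f).

Lemma card_GR4 r f : (0 < r)%N -> galois_poly r f -> #|GR4 f| = (4 ^ r)%N.
Proof.
by move=> r0 [mf sf _]; rewrite (card_monic_qpoly _ mf) sf ?ltnS // card_ord.
Qed.

Definition conn_set (f : {poly 'Z_4}) (G1 : {group {unit GR4 f}}) :
    {set GR4 f} :=
  [set val u | u in G1] :|: [set - val u | u in G1].

Lemma conn_setN f (G1 : {group {unit GR4 f}}) x :
  (- x \in conn_set G1) = (x \in conn_set G1).
Proof.
suff H y : y \in conn_set G1 -> - y \in conn_set G1.
  by apply/idP/idP => /H //; rewrite opprK.
rewrite !inE => /orP[] /imsetP[u Gu ->]; apply/orP; [right | left].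
  exact: imset_f.
by rewrite opprK; exact: imset_f.
Qed.

Lemma conn_set0 f (G1 : {group {unit GR4 f}}) : 0 \notin conn_set G1.
Proof.
rewrite !inE; apply/norP; split; apply/imsetP=> -[u _ /eqP]; rewrite eq_sym.
  by move/eqP=> u0; move: (valP u); rewrite /= u0 unitr0.
by rewrite oppr_eq0 => /eqP u0; move: (valP u); rewrite /= u0 unitr0.
Qed.

Definition H4 (f : {poly 'Z_4}) (G1 : {group {unit GR4 f}}) : rel (GR4 f) :=
  cayley (conn_set G1).

(* Main.v *)
(* Let q = 2^r and let T = G1 + {0} be the Teichmuller set of R = GR(4, 4^r).
   The eigenvalues of the Cayley graph are lam_chi = 2 Re g(chi) - 2, where chi
   ranges over the additive characters of R and g(chi) is the sum of chi over T.
   The set T is a difference set relative to 2R: each x outside 2R is t - u for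
   a unique pair in T. Hence |g(chi)|^2 is q or 0 for chi nontrivial. Since
   g(chi) is a Gaussian integer and q - 1 = 3 mod 4, its real part is never 1,
   so that 2 <= |lam_chi| <= 2 s + 2 with s = sqrt q. Summing the inequality
   (|lam| - 2) (2 s + 2 - |lam|) >= 0 over the nontrivial characters and using
   the second moment sum lam^2 = q^2 * 2 (q - 1) gives the required bound; the
   excess is a positive multiple of (q - 2)^2 + 2 s. *)
Require Import Defs.
From HB Require Import structures.
From mathcomp Require Import all_boot all_order all_algebra all_fingroup.
From mathcomp Require Import all_field qpoly.
From mathcomp Require Import all_solvable all_character ring zify.

Set Implicit Arguments.
Unset Strict Implicit.
Unset Printing Implicit Defensive.

Import Order.TTheory GRing.Theory Num.Theory.
Local Open Scope ring_scope.

(** * Spectra of abelian Cayley graphs *)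

(** Both characteristic matrices are intertwined by [P] over F[X], where the nonzero factor [\det P]
    cancels. *)
Lemma char_poly_conj (F : fieldType) n (P A B : 'M[F]_n) :
  P \in unitmx -> P *m A = B *m P -> char_poly A = char_poly B.
Proof.
move=> Pu PA; have detP : \det (map_mx polyC P) != 0.
  by rewrite det_map_mx polyC_eq0 -unitfE -unitmxE.
apply: (mulfI detP); rewrite -det_mulmx [RHS]mulrC -det_mulmx; congr (\det _).
rewrite /char_poly_mx mulmxBr mulmxBl -!map_mxM PA.
by rewrite mul_mx_scalar mul_scalar_mx.
Qed.

Section FiniteFourier.

Variable V : finZmodType.
Implicit Types (x y : V) (i : Iirr [set: V]) (S D : {set V}).

Lemma zmod_lin_char i : 'chi_i \is a linear_char.
Proof. exact/(char_abelianP _ (FinRing.zmod_abelian _)). Qed.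

Lemma chiD i x y : 'chi_i (x + y) = 'chi_i x * 'chi_i y.
Proof. by rewrite -(lin_charM (zmod_lin_char i)) ?inE. Qed.

Lemma chi0 i : 'chi_i (0 : V) = 1.
Proof. exact: lin_char1 (zmod_lin_char i). Qed.

Lemma chiN i x : 'chi_i (- x) = ('chi_i x)^*.
Proof. by rewrite -(lin_charV_conj (zmod_lin_char i)) ?inE. Qed.

Lemma chiMn i x n : 'chi_i (x *+ n) = 'chi_i x ^+ n.
Proof. by elim: n => [|n IH]; rewrite ?chi0 // mulrS chiD IH exprS. Qed.

(** All irreducible characters are linear, so their sum is the regular character. *)
Lemma sum_chi x : \sum_i 'chi[[set: V]]_i x = #|V|%:R *+ (x == 0).
Proof.
have := cfRegE [set: V]%G x; rewrite cardsT cfReg_sum sum_cfunE => <-.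
by apply: eq_bigr => i _; rewrite cfunE chi0 mul1r.
Qed.

(** Translating by [y] preserves [D] and multiplies the sum by ['chi_i y], which differs from 1.
    Applied below to the whole ring and to its 2-torsion. *)
Lemma sum_chi_period i D y :
  (forall x, (x + y \in D) = (x \in D)) -> 'chi_i y != 1 ->
  \sum_(x in D) 'chi_i x = 0.
Proof.
move=> Dy y1; apply/eqP; set s := \sum_(x in D) _.
have: s * 'chi_i y == s.
  rewrite /s mulr_suml [X in _ == X](reindex_inj (addIr y)) /=.
  by apply/eqP; apply: eq_big => x; rewrite ?Dy // chiD.
by rewrite -subr_eq0 -{2}[s]mulr1 -mulrBr mulf_eq0 subr_eq0 (negPf y1) orbF.
Qed.

Lemma exists_chi_neq1 i : i != 0 -> exists y, 'chi_i y != 1.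
Proof.
move=> i0; apply/existsP; apply: contraR i0; rewrite negb_exists => /forallP h.
rewrite -irr_eq1; apply/eqP/cfun_inP => x _; rewrite cfun1E in_setT.
by apply/eqP; rewrite -[_ == _]negbK h.
Qed.

(** The character table [P] satisfies P A = diag(lam) P, so the adjacency matrix is similar to the
    diagonal matrix of character sums. *)
Lemma cayley_spectrum S :
  perm_eq (spectrum (cayley S)) [seq \sum_(s in S) 'chi[[set: V]]_i s | i].
Proof.
have eN : #|V| = Nirr [set: V].
  rewrite NirrE -cardsT; apply/esym/eqP; rewrite -card_classes_abelian.
  exact: FinRing.zmod_abelian.
pose chi (j : 'I_#|V|) := 'chi_(cast_ord eN j).
pose lam j := \sum_(s in S) chi j s.
have sum_chij x : \sum_j chi j x = #|V|%:R *+ (x == 0).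
  rewrite -sum_chi (reindex (cast_ord eN)) //=.
  by exists (cast_ord (esym eN)) => j _; rewrite ?cast_ordK ?cast_ordKV.
pose P : 'M[algC]_#|V| := \matrix_(j, k) chi j (enum_val k : V).
have Pu : P \in unitmx.
  (* The conjugate transpose of [P] divided by |V| is its inverse, by column orthogonality. *)
  pose Q : 'M[algC]_#|V| :=
    \matrix_(k, j) ((chi j (enum_val k : V))^* / #|V|%:R).
  suff /mulmx1_unit[] : Q *m P = 1%:M by [].
  have N0 : #|V|%:R != 0 :> algC by rewrite pnatr_eq0 -cardsT -lt0n cardG_gt0.
  apply/matrixP=> k l; rewrite !mxE.
  transitivity ((\sum_j chi j (enum_val l - enum_val k)) / #|V|%:R).
    rewrite mulr_suml; apply: eq_bigr => j _.
    by rewrite !mxE mulrAC chiD chiN [X in X / _]mulrC.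
  rewrite sum_chij subr_eq0 (inj_eq enum_val_inj) [l == k]eq_sym.
  by case: (k == l); rewrite /= ?mul0r ?mulfV.
have PA : P *m adj_mx (cayley S) = diag_mx (\row_j lam j) *m P.
  apply/matrixP=> j k; rewrite mul_diag_mx !mxE.
  rewrite (eq_bigr (fun l => chi j (enum_val l)
                              * (enum_val l - enum_val k \in S)%:R)); last first.
    by move=> l _; rewrite !mxE.
  rewrite -(big_enum_val (A := V)
    (fun x : V => chi j x * (x - enum_val k \in S)%:R)).
  rewrite (reindex_inj (addIr (enum_val k))) /lam mulr_suml [RHS]big_mkcond /=.
  apply: eq_bigr => x _; rewrite addrK /chi chiD.
  by case: (x \in S); rewrite ?mulr1 ?mulr0.
apply: prod_XsubC_eq; rewrite -spectrumE (char_poly_conj Pu PA).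
rewrite char_poly_trig ?diag_mx_is_trig // big_map big_enum /=.
rewrite [RHS](reindex (cast_ord eN)) /=; last first.
  by exists (cast_ord (esym eN)) => j _; rewrite ?cast_ordK ?cast_ordKV.
by apply: eq_bigr => j _; rewrite !mxE eqxx.
Qed.

(** Expanding the square and summing over the characters first, only the pairs (s, -s) survive. *)
Lemma sum_sqr_chi_sums S : (forall x, (- x \in S) = (x \in S)) ->
  \sum_i (\sum_(s in S) 'chi[[set: V]]_i s) ^+ 2 = (#|V| * #|S|)%:R.
Proof.
move=> SN.
transitivity (\sum_(s in S) \sum_(t in S) \sum_i 'chi[[set: V]]_i (s + t)).
  under [RHS]eq_bigr => s _ do rewrite exchange_big.
  rewrite [RHS]exchange_big; apply: eq_bigr => i _.
  rewrite expr2 mulr_suml; apply: eq_bigr => s _.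
  by rewrite mulr_sumr; apply: eq_bigr => t _; rewrite chiD.
rewrite natrM mulrC mulr_natl -sumr_const; apply: eq_bigr => s Ss.
rewrite (bigD1 (- s)) ?SN //= sum_chi subrr eqxx.
rewrite big1 ?addr0 // => t /andP[_ ts].
by rewrite sum_chi addrC addr_eq0 (negPf ts).
Qed.

End FiniteFourier.

(** * Relative difference sets in rings of characteristic 4 *)

(* In GR(4, 4^r) this is the maximal ideal 2R. *)
Definition two_torsion (R : finComNzRingType) : {set R} :=
  [set x | x *+ 2 == 0].

Section RelativeDifferenceSet.

Variable R : finComNzRingType.
Local Notation M := (two_torsion R).

Lemma two_torsionD x y : y \in M -> (x + y \in M) = (x \in M).
Proof. by rewrite !inE mulrnDl => /eqP->; rewrite addr0. Qed.

Hypothesis four0 : 4%:R = 0 :> R.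
Hypothesis M_double : forall x, x \in M -> exists y, x = y *+ 2.
Hypothesis M_prime : forall x y : R, x * y \in M -> x \in M \/ y \in M.

Lemma double_two_torsion (x : R) : x *+ 2 \in M.
Proof. by rewrite inE -mulrnA -mulr_natr four0 mulr0. Qed.

(** Doubling maps [R] onto [M], and each fibre is a coset of [M]. *)
Lemma card_two_torsion : #|R| = (#|M| ^ 2)%N.
Proof.
have fib m : m \in M -> (\sum_(x : R | x *+ 2 == m) 1 = #|M|)%N.
  move=> /M_double[y ->]; rewrite sum1_card -(card_imset (mem M) (addrI y)).
  apply: eq_card => x; rewrite unfold_in.
  apply/eqP/imsetP => [xy|[z]]; last first.
    by rewrite inE => /eqP z2 ->; rewrite mulrnDl z2 addr0.
  exists (x - y); last by rewrite addrC subrK.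
  by rewrite inE mulrnBl xy subrr.
rewrite expnS expn1 -[LHS]sum1_card
  (partition_big (fun x => x *+ 2) (mem M)) /=; last first.
  by move=> x _; exact: double_two_torsion.
by rewrite -sum_nat_const; apply: eq_bigr.
Qed.

Lemma sqr_mod2 x y : x - y \in M -> x ^+ 2 = y ^+ 2.
Proof.
move=> /M_double[z /eqP]; rewrite subr_eq => /eqP->.
by have -> : (z *+ 2 + y) ^+ 2 = 4%:R * (z ^+ 2 + z * y) + y ^+ 2 by [ring];
  rewrite four0 mul0r add0r.
Qed.

(** Modulo 2 the factors x - y and x + y of the difference of squares coincide, and [M] is prime. *)
Lemma sqr_mod2_inj x y : x ^+ 2 - y ^+ 2 \in M -> x - y \in M.
Proof.
rewrite subr_sqr => /M_prime[//|xy].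
have -> : x - y = (x + y) + (- y) *+ 2 by ring.
by rewrite two_torsionD // double_two_torsion.
Qed.

Variable T : {set R}.
Hypothesis T_inj : {in T &, forall t u, t - u \in M -> t = u}.
Hypothesis T_sqr : forall t, t \in T -> exists2 s, s \in T & t = s ^+ 2.

(* With t, w, u, v the squares of t1, w1, u1, v1, squaring t1 + w1 = u1 + v1
   (mod 2) lifts it to Z/4 and yields t w = u v, so that t and w are roots of
   the same quadratic as u and v. *)
Lemma sum_unique t w u v : t \in T -> w \in T -> u \in T -> v \in T ->
  t + w = u + v -> t = u \/ t = v.
Proof.
move=> Tt Tw Tu Tv E.
have [[t1 _ Et] [w1 _ Ew]] := (T_sqr Tt, T_sqr Tw).
have [[u1 _ Eu] [v1 _ Ev]] := (T_sqr Tu, T_sqr Tv).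
have tw_uv : t * w = u * v.
  rewrite Et Ew Eu Ev -!exprMn; apply: sqr_mod2.
  have cong : t1 + w1 - (u1 + v1) \in M.
    apply: sqr_mod2_inj.
    have -> : (t1 + w1) ^+ 2 - (u1 + v1) ^+ 2 =
        (t1 ^+ 2 + w1 ^+ 2 - (u1 ^+ 2 + v1 ^+ 2)) + (t1 * w1 - u1 * v1) *+ 2.
      by ring.
    by rewrite -Et -Ew -Eu -Ev E subrr add0r double_two_torsion.
  rewrite inE; apply/eqP.
  have -> : (t1 * w1 - u1 * v1) *+ 2 =
      (t1 + w1) ^+ 2 - (u1 + v1) ^+ 2
      - (t1 ^+ 2 + w1 ^+ 2 - (u1 ^+ 2 + v1 ^+ 2)) by ring.
  by rewrite (sqr_mod2 cong) -Et -Ew -Eu -Ev E !subrr.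
have : (t - u) * (t - v) = 0.
  transitivity (t ^+ 2 - t * (u + v) + u * v); first by ring.
  by rewrite -E -tw_uv; ring.
move=> tuv0; have : (t - u) * (t - v) \in M by rewrite tuv0 inE mul0rn.
by case/M_prime => /T_inj; [left | right]; auto.
Qed.

Lemma diff_unique t w u v : t \in T -> w \in T -> u \in T -> v \in T ->
  t != u -> t - u = v - w -> t = v /\ u = w.
Proof.
move=> Tt Tw Tu Tv tu E.
have E' : t + w = v + u by rewrite -[t](subrK u) E; ring.
case: (sum_unique Tt Tw Tv Tu E') => [tv|tu']; last by rewrite tu' eqxx in tu.
by split=> //; apply: (@addrI _ t); rewrite E' tv.
Qed.

Hypothesis cardT : (#|T| ^ 2)%N = #|R|.

(** The diagonal pairs give the term at 0. On the other pairs the difference map is injective with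
    values outside [M], and a count shows that it reaches every such element. *)
Lemma sum_diff (A : zmodType) (F : R -> A) :
  \sum_(t in T) \sum_(u in T) F (t - u) = F 0 *+ #|T| + \sum_(x in ~: M) F x.
Proof.
pose D := [set p : R * R | [&& p.1 \in T, p.2 \in T & p.1 != p.2]].
pose d (p : R * R) := p.1 - p.2.
have d_inj : {in D &, injective d}.
  move=> [t u] [v w]; rewrite !inE /= => /and3P[Tt Tu tu] /and3P[Tv Tw _] E.
  by have [-> ->] := diff_unique Tt Tw Tu Tv tu E.
have cardTM : #|T| = #|M|.
  by apply/eqP; rewrite -(eqn_exp2r _ _ (isT : 0 < 2)%N) cardT card_two_torsion.
have im_d : d @: D = ~: M.
  apply/eqP; rewrite eqEcard card_in_imset //; apply/andP; split.
    apply/subsetP=> _ /imsetP[[t u] /[!inE]/= /and3P[Tt Tu tu] ->].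
    by apply: contra tu => tuM; apply/eqP/T_inj; rewrite ?inE.
  (* The complement of [M] has |T|^2 - |T| elements, while all pairs of elements of [T] lie in [D]
     or on the diagonal. *)
  rewrite cardsCs setCK -cardT -cardTM expnS expn1 -cardsX.
  have -> : #|T| = #|[set (t, t) | t in T]| by rewrite card_imset // => t u [].
  rewrite leq_subLR -cardsUI -[X in (X <= _)%N]addn0.
  rewrite leq_add // subset_leq_card //.
  apply/subsetP=> -[t u]; rewrite !inE /= => /andP[Tt Tu].
  rewrite Tt Tu /=; case: eqP => [->|]; rewrite ?orbT //.
  by rewrite (imset_f (fun t => (t, t))).
rewrite -im_d big_imset //= pair_big /=.
rewrite (bigID (fun p => p.1 == p.2)) /=; congr (_ + _); last first.
  by apply: eq_bigl => p; rewrite !inE -andbA.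
rewrite -sumr_const (eq_bigr (fun=> F 0)) => [|p /andP[_ /eqP->]]; last first.
  by rewrite subrr.
rewrite (reindex_onto (fun t => (t, t)) fst) => [|[t u] /andP[_ /eqP/=->]] //=.
by apply: eq_bigl => t; rewrite !eqxx !andbT andbb.
Qed.

End RelativeDifferenceSet.

(** * The Galois ring *)

Lemma red2_zmod_morphism : zmod_morphism red2.
Proof.
by move=> [[|[|[|[|//]]]] ?] [[|[|[|[|//]]]] ?]; apply/val_inj.
Qed.

Lemma red2_monoid_morphism : monoid_morphism red2.
Proof.
by split; last move=> [[|[|[|[|//]]]] ?] [[|[|[|[|//]]]] ?]; apply/val_inj.
Qed.

HB.instance Definition _ :=
  GRing.isZmodMorphism.Build _ _ red2 red2_zmod_morphism.
HB.instance Definition _ :=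
  GRing.isMonoidMorphism.Build _ _ red2 red2_monoid_morphism.

Lemma red2_eq0 a : (red2 a == 0) = (a *+ 2 == 0).
Proof. by case: a => [[|[|[|[|//]]]] ?]. Qed.

Lemma Z4_half (a : 'Z_4) : a *+ 2 = 0 -> a = (a != 0)%:R *+ 2.
Proof. by case: a => [[|[|[|[|//]]]] ?] // _; apply/val_inj. Qed.

Lemma irreducible_poly_prime (F : fieldType) (p a b : {poly F}) :
  irreducible_poly p -> p %| a * b -> (p %| a) || (p %| b).
Proof.
move=> irr; have [//|/= pa] := boolP (p %| a).
by rewrite Gauss_dvdpr // irreducible_poly_coprime.
Qed.

Section GaloisRing.

Variables (r : nat) (f : {poly 'Z_4}).

Lemma GR4_four0 : 4%:R = 0 :> GR4 f.
Proof.
apply/val_inj; apply: etrans (qpolyC_natr f 4) _; rewrite -(rmorph_nat polyC).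
by rewrite (_ : 4%:R = 0 :> 'Z_4) ?polyC0 //; apply/val_inj.
Qed.

Lemma val_double (x : GR4 f) : val (x *+ 2) = val x *+ 2.
Proof. by rewrite !mulr2n; exact: poly_of_qpolyD. Qed.

Lemma two_torsionE (x : GR4 f) :
  (x \in two_torsion (GR4 f)) = (val x *+ 2 == 0).
Proof. by rewrite inE -val_double. Qed.

Lemma two_torsion_red2 (x : GR4 f) :
  (x \in two_torsion (GR4 f)) = (map_poly red2 (val x) == 0).
Proof.
rewrite two_torsionE.
apply/eqP/eqP => /polyP h; apply/polyP=> i; have := h i;
  rewrite !coef_map !coef0 /=.
  by rewrite coefMn => /eqP; rewrite -red2_eq0 => /eqP.
by rewrite coefMn => /eqP; rewrite red2_eq0 => /eqP.
Qed.

Lemma GR4_double (x : GR4 f) :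
  x \in two_torsion (GR4 f) -> exists y : GR4 f, x = y *+ 2.
Proof.
rewrite two_torsionE => /eqP/polyP x2.
(* The coefficients of [val x] are 0 or 2 and are halved to 0 or 1. Since [p] is no longer than
   [val x], it is already reduced. *)
pose p : {poly 'Z_4} := \poly_(i < size (val x)) ((val x)`_i != 0)%:R.
have p_small : val (in_qpoly f p) = p.
  apply: in_qpoly_small; apply: leq_ltn_trans (size_poly _ _) _.
  apply: leq_ltn_trans (size_npoly x) _.
  by rewrite ltn_predL ltnW ?size_mk_monic_gt1.
exists (in_qpoly f p); apply/val_inj; rewrite val_double p_small.
apply/polyP=> i; have := x2 i; rewrite !coefMn coef0 coef_poly.
case: ltnP => [_ /Z4_half //|sx _].
by rewrite mul0rn nth_default.
Qed.

Hypotheses (r_gt0 : (0 < r)%N) (fP : galois_poly r f).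

(** Modulo 2 the ring becomes F_2[X] modulo an irreducible polynomial. If the product reduces to 0,
    the reduction of [f] divides that of one factor, whose degree below [r] forces it to vanish. *)
Lemma GR4_prime (x y : GR4 f) :
  x * y \in two_torsion (GR4 f) ->
  x \in two_torsion (GR4 f) \/ y \in two_torsion (GR4 f).
Proof.
case: fP => mf sf irr; rewrite !two_torsion_red2.
have -> : val (x * y) = Pdiv.Ring.rmodp (val x * val y) (mk_monic f).
  exact: poly_of_qpolyM.
move=> /eqP xy0.
have f_gt1 : (1 < size f)%N by rewrite sf ltnS.
have mkf : mk_monic f = f by rewrite /mk_monic f_gt1 mf.
have small (z : GR4 f) : map_poly red2 f %| map_poly red2 (val z) ->
    map_poly red2 (val z) == 0.
  apply: contraTT => z0; rewrite gtNdvdp //.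
  rewrite [ltnRHS]size_map_poly_id0 ?(monicP mf) ?rmorph1 ?oner_eq0 //.
  rewrite sf ltnS; apply: leq_trans (size_poly _ _) _.
  by apply: leq_trans (size_npoly z) _; rewrite mkf sf.
have : map_poly red2 f %| map_poly red2 (val x) * map_poly red2 (val y).
  rewrite -rmorphM /= (Pdiv.RingMonic.rdivp_eq mf (val x * val y)).
  rewrite rmorphD rmorphM /= -[X in _ + map_poly _ (_ _ X)]mkf xy0 addr0.
  by rewrite dvdp_mull.
by case/(irreducible_poly_prime irr)/orP => /small; [left | right].
Qed.

End GaloisRing.

(** * Gauss sums over the Teichmuller set *)

Lemma Re_Im_int_unity4 (z : algC) :
  z ^+ 4 = 1 -> ('Re z \is a Num.int) && ('Im z \is a Num.int).
Proof.
move=> z4; have /eqP : (z - 1) * (z + 1) * ((z - 'i) * (z + 'i)) = 0.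
  (* [ring] treats ['i] as a variable; the correction term vanishes because i^2 = -1. *)
  transitivity (z ^+ 4 - 1 - ('i ^+ 2 + 1) * (z ^+ 2 - 1) : algC).
    by ring.
  by rewrite sqrCi addNr mul0r z4 !subrr.
rewrite !mulf_eq0 !subr_eq0 !addr_eq0 -!orbA.
case/or4P => /eqP->; rewrite ?raddfN ?rpredN /= ?Re_i ?Im_i ?rpred0 ?rpred1 //.
  by rewrite (Creal_ReP _ _) ?(Creal_ImP _ _) ?rpred0 ?rpred1.
by rewrite (Creal_ReP _ _) ?(Creal_ImP _ _) ?rpred0 ?rpred1.
Qed.

(** Modulo 4 the left side is 1 or 2 and the right side is 0. *)
Lemma sqr_add1_neq_pow2 n r : (2 <= r)%N -> (n ^ 2 + 1 <> 2 ^ r)%N.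
Proof.
case: r => [|[|r]] // _; rewrite !expnS expn0 -(odd_double_half n).
by case: (odd n) => /=; lia.
Qed.

Section Teichmuller.

Variables (R : finComUnitRingType) (G : {group {unit R}}).
Local Notation M := (two_torsion R).

Hypothesis four0 : 4%:R = 0 :> R.
Hypothesis M_double : forall x, x \in M -> exists y, x = y *+ 2.
Hypothesis M_prime : forall x y : R, x * y \in M -> x \in M \/ y \in M.
Hypothesis oddG : odd #|G|.
Hypothesis cardG : (#|G|.+1 ^ 2)%N = #|R|.

Definition teichmuller : {set R} := 0 |: [set val u | u in G].
Local Notation T := teichmuller.

(** As |G| is odd, (|G| + 1) / 2 inverts 2 modulo |G|. *)
Lemma group_sqrtK u : u \in G -> ((u ^+ (#|G|.+1)./2) ^+ 2)%g = u.
Proof.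
by move=> Gu; rewrite -expgM muln2 halfK /= oddG subn0 expgS expg_cardG ?mulg1.
Qed.

Lemma val_unitX (u : {unit R}) n : val (u ^+ n)%g = val u ^+ n.
Proof. by elim: n => [|n IH] //; rewrite expgS exprS -IH. Qed.

(** Elements of [M] are congruent to 0 modulo 2, so they square to 0. *)
Lemma unit_notin_two_torsion (u : {unit R}) : val u \notin M.
Proof.
apply/negP; rewrite -[val u]subr0 => /(sqr_mod2 four0 M_double) u2.
by have := valP u; rewrite -(unitrX_pos _ (isT : 0 < 2)%N) u2 expr0n unitr0.
Qed.

(** Units congruent modulo 2 have equal squares, and squaring is injective on a group of odd
    order. *)
Lemma unit_mod2_inj : {in G &, forall u v, val u - val v \in M -> u = v}.
Proof.
move=> u v Gu Gv /(sqr_mod2 four0 M_double) uv2.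
have {}uv2 : (u ^+ 2 = v ^+ 2)%g by apply/val_inj; rewrite !val_unitX.
by rewrite -(group_sqrtK Gu) -(group_sqrtK Gv) -!expgM mulnC !expgM uv2.
Qed.

Lemma two_torsionN (x : R) : (- x \in M) = (x \in M).
Proof. by rewrite !inE mulNrn oppr_eq0. Qed.

Lemma teichmuller_inj : {in T &, forall t u, t - u \in M -> t = u}.
Proof.
move=> t u /setU1P[-> | /imsetP[a Ga ->]] /setU1P[-> | /imsetP[b Gb ->]] //.
- by rewrite sub0r two_torsionN (negPf (unit_notin_two_torsion b)).
- by rewrite subr0 (negPf (unit_notin_two_torsion a)).
- by move/(unit_mod2_inj Ga Gb)->.
Qed.

Lemma teichmuller_sqrt t : t \in T -> exists2 s, s \in T & t = s ^+ 2.
Proof.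
case/setU1P=> [-> | /imsetP[u Gu ->]].
  by exists 0; rewrite ?setU11 ?expr0n.
exists (val (u ^+ (#|G|.+1)./2)%g).
  by apply/setU1P; right; rewrite imset_f ?groupX.
by rewrite -val_unitX group_sqrtK.
Qed.

Lemma val_unit_neq0 (u : {unit R}) : val u != 0.
Proof.
by apply: contraNneq (unit_notin_two_torsion u) => ->; rewrite inE mul0rn.
Qed.

Lemma zero_notin_units : 0 \notin [set val u | u in G].
Proof.
by apply/imsetP=> -[u _ /eqP]; rewrite eq_sym (negPf (val_unit_neq0 u)).
Qed.

Lemma card_teichmuller : #|T| = #|G|.+1.
Proof. by rewrite cardsU1 zero_notin_units card_imset //; exact: val_inj. Qed.

(* conn_set, over any finite commutative ring. *)
Definition connection : {set R} :=
  [set val u | u in G] :|: [set - val u | u in G].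

Lemma sum_connection (A : nmodType) (F : R -> A) :
  \sum_(s in connection) F s = \sum_(u in G) (F (val u) + F (- val u)).
Proof.
have disj : [disjoint [set val u | u in G] & [set - val u | u in G]].
  rewrite -setI_eq0; apply/eqP/setP=> x; rewrite !inE; apply/negP.
  case/andP=> /imsetP[u Gu ->] /imsetP[v Gv uv].
  (* If u = -v, then u - v = -2v lies in [M], hence u = v and 2v = 0, impossible for a unit. *)
  have /(unit_mod2_inj Gu Gv) u_v : val u - val v \in M.
    by rewrite uv -opprD -mulr2n two_torsionN double_two_torsion.
  have := unit_notin_two_torsion v; rewrite inE; case/negP.
  by rewrite u_v in uv; rewrite mulr2n {1}uv addNr.
rewrite (eq_bigl [predU [set val u | u in G] & [set - val u | u in G]]);
  last first.
  by move=> x; rewrite !inE.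
rewrite (bigU _ _ _ disj) /=.
rewrite big_split /= big_imset ?big_imset //=.
  by move=> u v _ _ /oppr_inj/val_inj.
by move=> u v _ _ /val_inj.
Qed.

Variable i : Iirr [set: R].

Definition gauss_sum : algC := \sum_(t in T) 'chi_i t.

Lemma gauss_sumE : gauss_sum = 1 + \sum_(u in G) 'chi_i (val u).
Proof.
rewrite /gauss_sum big_setU1 ?zero_notin_units //= chi0.
by rewrite big_imset //= => u v _ _ /val_inj.
Qed.

Lemma sum_chi_connection :
  \sum_(s in connection) 'chi_i s = 2 * ('Re gauss_sum - 1).
Proof.
rewrite sum_connection big_split /=.
rewrite (eq_bigr (fun u => ('chi_i (val u))^*)
  (F1 := fun u => 'chi_i (- val u))).
  rewrite -rmorph_sum /= gauss_sumE raddfD /= (Creal_ReP 1 _) ?rpred1 //.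
  by rewrite addrAC subrr add0r ReE mulrC divfK ?pnatr_eq0.
by move=> u _; rewrite chiN.
Qed.

Lemma gauss_sum_int :
  ('Re gauss_sum \is a Num.int) && ('Im gauss_sum \is a Num.int).
Proof.
have chi_int t :
    ('Re ('chi_i t) \is a Num.int) && ('Im ('chi_i t) \is a Num.int).
  by apply: Re_Im_int_unity4; rewrite -chiMn -mulr_natr four0 mulr0 chi0.
rewrite /gauss_sum !raddf_sum /=.
by rewrite !rpred_sum // => t _; case/andP: (chi_int t).
Qed.

(** Expanding the norm over differences gives |T| plus the sum of the character outside [M]. As the
    full sum vanishes, this is |T| minus the sum over [M], which is |M| = |T| if the character is
    trivial on [M] and 0 otherwise. *)
Lemma normC2_gauss_sum : i != 0 ->
  `|gauss_sum| ^+ 2 = #|T|%:R \/ `|gauss_sum| ^+ 2 = 0.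
Proof.
move=> i0.
have cardT : (#|T| ^ 2)%N = #|R| by rewrite card_teichmuller.
have -> : `|gauss_sum| ^+ 2 = #|T|%:R - \sum_(x in M) 'chi_i x.
  rewrite normCK /gauss_sum rmorph_sum /= mulr_suml.
  transitivity (\sum_(t in T) \sum_(u in T) 'chi_i (t - u)).
    apply: eq_bigr => t _; rewrite mulr_sumr; apply: eq_bigr => u _.
    by rewrite chiD chiN.
  have := sum_diff four0 M_double M_prime teichmuller_inj teichmuller_sqrt
    cardT (fun x => 'chi_i x).
  move=> /= ->; rewrite chi0; congr (_ + _).
  have [y y1] := exists_chi_neq1 i0.
  have RD (x : R) : (x + y \in [set: R]) = (x \in [set: R]) by rewrite !in_setT.
  have /eqP := sum_chi_period RD y1.
  rewrite (bigID (mem M)) /= addr_eq0 => /eqP.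
  rewrite (eq_bigl (mem M)) => [->|x]; last by rewrite inE.
  by rewrite opprK; apply: eq_bigl => x; rewrite !inE.
have [/forall_inP triv | /forall_inPn[y yM y1]] :=
    boolP [forall (y | y \in M), 'chi_i y == 1].
  right; rewrite (eq_bigr (fun=> 1)) => [|x /triv/eqP//].
  suff -> : #|T| = #|M| by rewrite sumr_const subrr.
  apply/eqP; rewrite -(eqn_exp2r _ _ (isT : 0 < 2)%N) cardT.
  by rewrite (card_two_torsion four0 M_double).
by left; rewrite (sum_chi_period _ y1) ?subr0 // => x; exact: two_torsionD.
Qed.

Lemma sum_chi_connection_bounds r : (2 <= r)%N -> #|T| = (2 ^ r)%N -> i != 0 ->
  let lam := \sum_(s in connection) 'chi_i s in
  [/\ lam \is Num.real, 2 <= `|lam| & `|lam| <= 2 * sqrtC #|T|%:R + 2].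
Proof.
move=> r2 cardT i0 /=; rewrite sum_chi_connection.
have /andP[aZ bZ] := gauss_sum_int.
have N2 := normC2_gauss_sum i0.
set a := 'Re gauss_sum in aZ *.
have aR : a \is Num.real := Creal_Re _.
split; first by rewrite rpredM ?rpredB ?rpred1 ?realn.
  rewrite normrM normr_nat ler_peMr // norm_intr_ge1 ?rpredB ?rpred1 //.
  (* A real part equal to 1 would give |g|^2 = 1 + n^2 with n = |Im g|, which is neither 2^r nor 0.
     So Re g - 1 is a nonzero integer. *)
  rewrite subr_eq0; apply/eqP => a1.
  have /natrP[n bn] := natr_norm_int bZ.
  move: N2; rewrite normC2_Re_Im -/a a1 expr1n -(intr_normK bZ) bn cardT.
  rewrite -natrX addrC natr1 => -[] /eqP.
  - by rewrite eqr_nat -addn1 => /eqP; exact: sqr_add1_neq_pow2.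
  - by rewrite pnatr_eq0.
have le_a : `|a| <= sqrtC #|T|%:R.
  apply: le_trans (_ : `|gauss_sum| <= _).
    rewrite -ler_sqr ?nnegrE // (normC2_Re_Im gauss_sum) intr_normK // lerDl.
    by rewrite -(intr_normK bZ) exprn_ge0.
  rewrite -ler_sqr ?nnegrE ?sqrtC_ge0 ?ler0n // sqrtCK.
  by case: N2 => ->; rewrite ?ler0n.
have -> : 2 * sqrtC #|T|%:R + 2 = 2 * (sqrtC #|T|%:R + 1) :> algC by ring.
rewrite normrM normr_nat ler_pM2l ?ltr0n //.
by apply: le_trans (ler_normB _ _) _; rewrite normr1 lerD2r.
Qed.

End Teichmuller.

(** * Energy bounds from the second moment *)

Lemma energy_cayley (V : finZmodType) (S : {set V}) :
  energy (cayley S) = \sum_i `|\sum_(s in S) 'chi[[set: V]]_i s|.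
Proof.
by rewrite /energy (perm_big _ (cayley_spectrum S)) big_map big_enum.
Qed.

(** The constants 2 s + 4 and 4 (s + 1) are the sum and the product of the bounds 2 and 2 s + 2. The
    trivial character has eigenvalue |S| and is treated apart: it adds |S| (2 s + 4), and its square
    is removed from the second moment |V| |S|. *)
Lemma energy_lower_bound (V : finZmodType) (S : {set V}) (s : algC) :
  (forall x, (- x \in S) = (x \in S)) -> 0 <= s ->
  (forall i : Iirr [set: V], i != 0 ->
     let lam := \sum_(x in S) 'chi_i x in
     [/\ lam \is Num.real, 2 <= `|lam| & `|lam| <= 2 * s + 2]) ->
  #|S|%:R * (2 * s + 4) + #|V|%:R * #|S|%:R - #|S|%:R ^+ 2
    + 4 * (s + 1) * (#|V|%:R - 1) <= energy (cayley S) * (2 * s + 4).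
Proof.
move=> SN s0 bounds; rewrite energy_cayley.
pose lam i := \sum_(x in S) 'chi[[set: V]]_i x; rewrite -/lam.
have lam0 : lam 0 = #|S|%:R.
  rewrite /lam -sum1_card natr_sum; apply: eq_bigr => x _.
  by rewrite irr0 cfun1E in_setT.
have sum_lam2 := sum_sqr_chi_sums SN; rewrite -/lam natrM in sum_lam2.
have cardI : \sum_(i : Iirr [set: V]) 1 = #|V|%:R :> algC.
  have := sum_chi (0 : V); rewrite eqxx mulr1n => <-.
  by apply: eq_bigr => i _; rewrite chi0.
rewrite -sum_lam2 -cardI.
have split0 (F : Iirr [set: V] -> algC) :
    \sum_i F i = F 0 + \sum_(i | i != 0) F i by rewrite (bigD1 0).
rewrite (split0 (fun i => `|lam i|)) (split0 (fun i => lam i ^+ 2)).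
rewrite (split0 (fun=> 1)) lam0 normr_nat [leRHS]mulrDl.
set X := \sum_(i | _) `|_|; set Y := \sum_(i | _) lam _ ^+ 2.
set Z := \sum_(i | _) 1.
have -> : #|S|%:R * (2 * s + 4) + (#|S|%:R ^+ 2 + Y) - #|S|%:R ^+ 2
    + 4 * (s + 1) * (1 + Z - 1) = #|S|%:R * (2 * s + 4) + (Y + 4 * (s + 1) * Z).
  by ring.
rewrite lerD2l /X /Y /Z mulr_suml mulr_sumr -big_split /=.
apply: ler_sum => i /bounds[]; rewrite -/(lam i) => lamR lam_ge lam_le.
rewrite -(real_normK lamR) -subr_ge0.
have -> : `|lam i| * (2 * s + 4) - (`|lam i| ^+ 2 + 4 * (s + 1) * 1) =
    (`|lam i| - 2) * (2 * s + 2 - `|lam i|) by ring.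
by rewrite mulr_ge0 ?subr_ge0.
Qed.

Theorem theorem5p2 (r : nat) (f : {poly 'Z_4}) (G1 : {group {unit GR4 f}}) :
  (2 <= r)%N -> galois_poly r f -> #|G1| = (2 ^ r - 1)%N ->
  hyperenergetic (H4 G1).
Proof.
move=> r2 fP cardG1; have r0 := ltnW r2.
have four0 := GR4_four0 f.
have M_double := @GR4_double f.
have M_prime := @GR4_prime r f r0 fP.
have G1S : #|G1|.+1 = (2 ^ r)%N by rewrite cardG1 subn1 prednK ?expn_gt0.
have oddG : odd #|G1|.
  by have := congr1 odd G1S; rewrite /= oddX eqn0Ngt r0 => /negbFE.
have cardR : (#|G1|.+1 ^ 2)%N = #|GR4 f|.
  by rewrite (card_GR4 r0 fP) G1S -expnM mulnC expnM.
have cardT := card_teichmuller G1 four0 M_double.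
rewrite G1S in cardT.
pose q : algC := (2 ^ r)%:R; pose s : algC := sqrtC q.
have s0 : 0 <= s by rewrite sqrtC_ge0 ler0n.
have q1 : 0 < q - 1 by rewrite subr_gt0 ltr1n -(expn0 2) ltn_exp2l.
have cardS : #|conn_set G1|%:R = 2 * (q - 1) :> algC.
  (* Counting the connection set as a sum of ones reuses the disjointness of G1 and -G1. *)
  rewrite -sum1_card natr_sum.
  rewrite (sum_connection four0 M_double oddG (fun=> 1)) sumr_const cardG1.
  by rewrite -[LHS]mulr_natr natrB ?expn_gt0.
have cardN : #|GR4 f|%:R = q ^+ 2 :> algC by rewrite -cardR G1S natrX.
have bounds i (i0 : i != 0) :=
  sum_chi_connection_bounds four0 M_double M_prime oddG cardR r2 cardT i0.
rewrite cardT in bounds.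
have := energy_lower_bound (conn_setN G1) s0 bounds.
rewrite /hyperenergetic -/(H4 G1) cardN cardS => bound.
have s4 : 0 < 2 * s + 4 by rewrite ltr_wpDl ?mulr_ge0.
rewrite -(ltr_pM2r s4); apply: lt_le_trans bound; rewrite -subr_gt0.
(* The excess of the lower bound over 2 (q^2 - 1), both scaled by 2 s + 4. It is positive since q >
   1 and s > 0. *)
have -> : 2 * (q - 1) * (2 * s + 4)
    + q ^+ 2 * (2 * (q - 1)) - (2 * (q - 1)) ^+ 2
    + 4 * (s + 1) * (q ^+ 2 - 1) - 2 * (q ^+ 2 - 1) * (2 * s + 4)
  = 2 * (q - 1) * ((q - 2) ^+ 2 + 2 * s) by ring.
have q2 : 0 <= q - 2 by rewrite subr_ge0 ler_nat -[leqLHS]expn1 leq_exp2l.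
rewrite mulr_gt0 ?mulr_gt0 // ltr_wpDl ?exprn_ge0 // mulr_gt0 //.
by rewrite sqrtC_gt0 ltr0n expn_gt0.
Qed.
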